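(* Let $F$ be a field and let $A$ be a (finitely generated) monomial $F$-algebra. Then \[\mathrm{pro}(A)=\bigcap_{P\ \text{a point } A\text{-module}}\mathrm{Ann}_A(P).\]
   Context: A monomial algebra is a quotient of a finitely generated free associative algebra $F\langle x_1,\dots,x_m\rangle$ by an ideal generated by monomials, graded by $\deg x_i=1$. The (right) prolongable radical of a connected graded algebra $A=\bigoplus_{n\ge 0} A_n$ generated in degree $1$ is $\mathrm{pro}(A)=\{f\in A : \exists d\ge1,\ f\cdot A_d=0\}$. A point $A$-module is a graded cyclic right $A$-module $P=\bigoplus_{n\ge0}P_n$ generated in degree $0$ with $\dim_FP_n=1$ for all $n\ge0$. An empty intersection is taken to be $A$. *)

(* Defs.v *)
From HB Require Import structures.
From mathcomp Require Import all_boot all_algebra.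
From mathcomp Require Import finmap monalg.
From mathcomp Require Import classical_sets.

Set Implicit Arguments.
Unset Strict Implicit.
Unset Printing Implicit Defensive.

Import GRing.Theory.

Local Open Scope classical_set_scope.
Local Open Scope ring_scope.

(* F<x_0, ..., x_(m-1)>, as the monoid algebra of the free monoid on 'I_m. *)
Notation freeAlg F m := {malg F[{fmonom 'I_m}]}.

Section Ideals.
Variable R : nzRingType.

Definition two_sided_ideal (J : set R) : Prop :=
  [/\ J 0, (forall x y, J x -> J y -> J (x + y)) &
      (forall r x, J x -> J (r * x) /\ J (x * r))].

Definition gen_ideal (X : set R) : set R :=
  \bigcap_(J in [set J | two_sided_ideal J /\ X `<=` J]) J.

End Ideals.

Section MonomialAlgebras.
Variables (F : fieldType) (m : nat).

(* A is the quotient of the free algebra, with projection pi, by the two-sided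
   ideal generated by some (possibly infinite) set S of monomials.  As 1 != 0
   in every algType, the empty word does not lie in S. *)
Definition is_monomial_algebra (A : algType F)
    (pi : {lrmorphism freeAlg F m -> A}) : Prop :=
  (forall a : A, exists f, pi f = a) /\
  exists S : set {fmonom 'I_m},
    [set f | pi f = 0] = gen_ideal [set << w >> | w in S].

Definition free_component (n : nat) : set (freeAlg F m) :=
  [set f | forall w, w \in msupp f -> fdeg w = n].

(* The grading induced on the quotient by deg x_i = 1. *)
Definition quot_component (A : algType F) (pi : {lrmorphism freeAlg F m -> A})
    (n : nat) : set A :=
  pi @` free_component n.

End MonomialAlgebras.

(* Right A-modules are left modules over the converse ring A^c. *)
Definition ract (A : nzRingType) (P : lmodType A^c) (p : P) (a : A) : P :=
  (a : A^c) *: p.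

Section RightGradedModules.
Variables (F : fieldType) (A : algType F) (gr : nat -> set A).

Definition pro : set A :=
  [set f | exists2 d, (1 <= d)%N & forall a, gr d a -> f * a = 0].

Section Module.
Variable P : lmodType A^c.

Definition ann : set A := [set a | forall p : P, ract p a = 0].

(* P is an F-vector space through F -> A, c |-> c%:A. *)
Definition is_subspace (U : set P) : Prop :=
  [/\ U 0, (forall p q, U p -> U q -> U (p + q)) &
      (forall (c : F) p, U p -> U (ract p c%:A))].

Definition has_dim (U : set P) (d : nat) : Prop :=
  exists2 e : 'I_d -> P, (forall i, U (e i)) &
    forall p, U p ->
      exists! c : {ffun 'I_d -> F}, p = \sum_(i < d) ract (e i) (c i)%:A.

Definition is_direct_sum (comp : nat -> set P) : Prop :=
  (forall p : P, exists n (q : nat -> P),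
     (forall i, comp i (q i)) /\ p = \sum_(i < n) q i) /\
  (forall n (q : nat -> P), (forall i, comp i (q i)) ->
     \sum_(i < n) q i = 0 -> forall i, (i < n)%N -> q i = 0).

Definition is_graded_module (comp : nat -> set P) : Prop :=
  [/\ (forall n, is_subspace (comp n)),
      is_direct_sum comp &
      (forall i j p a, comp i p -> gr j a -> comp (i + j)%N (ract p a))].

Definition cyclic_in_degree0 (comp : nat -> set P) : Prop :=
  exists2 p0, comp 0%N p0 & forall p, exists a, p = ract p0 a.

End Module.

Record point_module := PointModule {
  pm_sort :> lmodType A^c;
  pm_comp : nat -> set pm_sort;
  pm_graded : is_graded_module pm_comp;
  pm_cyclic : cyclic_in_degree0 pm_comp;
  pm_dim1 : forall n, has_dim (pm_comp n) 1
}.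

(* The intersection of the Ann_A(P) over all point modules P (all of A if there
   is none).  \bigcap cannot be used: its index type lives in a universe below
   that of lmodType. *)
Definition bigcap_ann_point_modules : set A :=
  [set a | forall P : point_module, ann P a].

End RightGradedModules.

(* Main.v *)
(* In a point module P, every nonzero homogeneous q satisfies q A_d <> 0, since
   P_(n+d) = P_n A_d and P_n = F q; hence pro(A) annihilates P.  Conversely, an
   infinite word s with no zero prefix gives a point module with basis
   p_0, p_1, ..., where p_n x = p_(n+1) if x = s_n and p_n x = 0 for the other
   letters x; the image of p_0 under f shows the coefficients in f of all
   prefixes of s.  If f annihilates every point module, no word of f is thus a
   prefix of such an s, and by Koenig's lemma each word w of f has w A_d = 0 for
   some d. *)

Require Import Defs.
From HB Require Import structures.
From mathcomp Require Import all_boot all_algebra.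
From mathcomp Require Import finmap monalg.
From mathcomp Require Import boolp.
From mathcomp Require Import classical_sets.

Set Implicit Arguments.
Unset Strict Implicit.
Unset Printing Implicit Defensive.

Import GRing.Theory.

Local Open Scope classical_set_scope.
Local Open Scope ring_scope.

(** * König's lemma for prefix-closed sets of words over a finite alphabet *)

Section Koenig.
Variables (T : finType) (N : set (seq T)).
Hypothesis N_prefix : forall u v, N (u ++ v) -> N u.

Definition extendable : set (seq T) :=
  [set u | forall d, exists2 v, size v = d & N (u ++ v)].

(** If every letter [x] had a length [d x] at which the extensions of [rcons u x] in [N] stop, then,
    the alphabet being finite, a long enough extension of [u] would exceed all these bounds. *)
Lemma extendable_rcons u : extendable u -> exists x, extendable (rcons u x).
Proof.
move=> uE; apply: contrapT => noext.
have /choice[d dP] : forall x, exists d,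
    forall v, size v = d -> ~ N (rcons u x ++ v).
  move=> x; apply: contrapT => H; apply: noext; exists x => d.
  apply: contrapT => H'; apply: H; exists d => v sv Nv; apply: H'.
  by exists v.
(* The successor pays for the first letter [x]; the remaining [v] still has at least [d x]
   letters. *)
have [[//|x v] [sv] Nv] := uE (\max_x d x).+1.
have le_dv : (d x <= size v)%N by rewrite sv leq_bigmax.
apply: (dP x (take (d x) v)); first by rewrite size_takel.
by apply: (@N_prefix _ (drop (d x) v)); rewrite -catA cat_take_drop cat_rcons.
Qed.

Lemma koenig u : extendable u ->
  exists s : nat -> T, mkseq s (size u) = u /\ forall n, N (mkseq s n).
Proof.
(* This letter serves as the default for [nth] and as the value of [nxt] on words that are not
   extendable. *)
move=> uE; have [x0 _] := extendable_rcons uE.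
have /choice[nxt nxtP] : forall v, exists x,
    extendable v -> extendable (rcons v x).
  move=> v; have [/extendable_rcons[x ?]|?] := pselect (extendable v).
    by exists x.
  by exists x0.
pose t n := iter n (fun v => rcons v (nxt v)) u.
have tE n : extendable (t n) by elim: n => // n /nxtP.
have size_t n : size (t n) = (size u + n)%N.
  by elim: n => [|n IHn]; rewrite ?addn0 //= size_rcons IHn addnS.
have nth_t n k i : (i < size (t n))%N ->
    nth x0 (t (k + n)%N) i = nth x0 (t n) i.
  move=> lti; elim: k => // k; rewrite addSn /= nth_rcons => ->.
  by rewrite (leq_trans lti) // !size_t leq_add2l leq_addl.
(* Stage [i.+1] has length at least [i.+1], so the default [x0] is never read. *)
pose s i := nth x0 (t i.+1) i.
have sP n k : (k <= size (t n))%N -> mkseq s k = take k (t n).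
  move=> lek; apply: (@eq_from_nth _ x0).
    by rewrite size_mkseq size_takel.
  move=> i; rewrite size_mkseq => lti; rewrite nth_mkseq // nth_take // /s.
  (* Stages [n] and [i.+1] are compared at a common later stage, of which both are prefixes. *)
  rewrite -(nth_t i.+1 n) ?size_t ?addnS ?ltnS ?leq_addl //.
  by rewrite -addnS addnC nth_t // (leq_trans lti).
exists s; split; first by rewrite (sP 0%N) // take_size.
move=> n; rewrite (sP n) ?size_t ?leq_addl //.
(* Extendability at length 0 puts [t n] itself in [N]. *)
have [v _] := tE n 0%N; rewrite -{1}(cat_take_drop n (t n)) -catA.
exact: N_prefix.
Qed.

End Koenig.

(** * Images of words and homogeneous decomposition in the quotient *)

Section Words.
Variables (F : fieldType) (m : nat) (A : algType F).
Variable pi : {lrmorphism freeAlg F m -> A}.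

Definition word_image (w : seq 'I_m) : A := pi << FMonom w >>.

Local Notation gr := (quot_component pi).

Lemma fmonomM (u v : {fmonom 'I_m}) : mmul u v = FMonom (u ++ v).
Proof. by apply/eqP; rewrite fmP fmM. Qed.

Lemma malgU_mul (u v : {fmonom 'I_m}) :
  << u >> * << v >> = << FMonom (u ++ v) >> :> freeAlg F m.
Proof. by rewrite malgM_def fgmulUU mulr1 fmonomM. Qed.

Lemma word_image_cat u v : word_image (u ++ v) = word_image u * word_image v.
Proof. by rewrite /word_image -rmorphM malgU_mul. Qed.

Lemma word_image_component w : gr (size w) (word_image w).
Proof.
by exists << FMonom w >> => // v; rewrite msuppU1 inE => /eqP ->.
Qed.

Lemma pi_sum (f : freeAlg F m) :
  pi f = \sum_(w <- msupp f) f@_w *: word_image w.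
Proof.
rewrite {1}(monalgE f) raddf_sum; apply: eq_bigr => w _.
rewrite /word_image fmK -linearZ; congr (pi _).
by apply/malgP => k; rewrite mcoeffZ !mcoeffU mulrnAr mulr1.
Qed.

Lemma componentZ n c (a : A) : gr n a -> gr n (c *: a).
Proof.
move=> [f fn <-]; exists (c *: f); last by rewrite linearZ.
by move=> w /(fsubsetP (msuppZ_le _ _)) /fn.
Qed.

Lemma componentD n (a b : A) : gr n a -> gr n b -> gr n (a + b).
Proof.
move=> [f fn <-] [g gn <-]; exists (f + g); last by rewrite raddfD.
by move=> w /(fsubsetP (msuppD_le _ _)); rewrite inE => /orP[/fn|/gn].
Qed.

Lemma component0 n : gr n 0.
Proof. by exists 0; [move=> w; rewrite msupp0 inE | rewrite raddf0]. Qed.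

(** The words of [f] are grouped by length. The sum is allowed any range beyond [N], so that later
    proofs can enlarge it to include a given degree. *)
Lemma component_decomposition (f : freeAlg F m) :
  exists N (a : nat -> A), (forall i, gr i (a i)) /\
    forall n, (N <= n)%N -> pi f = \sum_(i < n) a i.
Proof.
exists (\max_(w <- msupp f) (fdeg w).+1)%N.
exists (fun i => \sum_(w <- msupp f | fdeg w == i) f@_w *: word_image w).
split=> [i|n le_n].
  elim/big_ind: _ => [|a b|w /eqP <-]; first exact: component0.
    exact: componentD.
  by apply: componentZ; apply: word_image_component.
rewrite pi_sum (exchange_big_dep xpredT) //= big_seq [RHS]big_seq.
apply: eq_bigr => w wf.
have ltw : (fdeg w < n)%N.
  by apply: leq_trans le_n;
    apply: (@leq_bigmax_seq _ _ _ (fun w => (fdeg w).+1)).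
by rewrite (big_pred1 (Ordinal ltw)) // => i; rewrite eq_sym.
Qed.

(** * Point modules are annihilated by the prolongable radical *)

Section PointModule.
Hypothesis pi_surj : forall a, exists f, pi f = a.
Variable P : point_module gr.

Local Notation comp := (@pm_comp _ _ _ P).
Implicit Types (p q : P) (a b : A).

Lemma ractM p a b : ract p (a * b) = ract (ract p a) b.
Proof. by rewrite /ract scalerA. Qed.

Lemma ract_sumr p I r (Q : pred I) (a : I -> A) :
  ract p (\sum_(i <- r | Q i) a i) = \sum_(i <- r | Q i) ract p (a i).
Proof. exact: scaler_suml. Qed.

Lemma ract_suml a I r (Q : pred I) (q : I -> P) :
  ract (\sum_(i <- r | Q i) q i) a = \sum_(i <- r | Q i) ract (q i) a.
Proof. exact: scaler_sumr. Qed.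

Lemma ract0r p : ract p 0 = 0. Proof. exact: scale0r. Qed.

Lemma ract0l a : ract (0 : P) a = 0. Proof. exact: scaler0. Qed.

Lemma ract1 p : ract p 1 = p. Proof. exact: scale1r. Qed.

Lemma ract_scalar p (c : F) a : ract (ract p c%:A) a = ract (ract p a) c%:A.
Proof. by rewrite -!ractM -scalerAl -scalerAr mul1r mulr1. Qed.

Lemma comp0 n : comp n 0.
Proof. by have [/(_ n)[]] := pm_graded P. Qed.

Lemma compD n p q : comp n p -> comp n q -> comp n (p + q).
Proof. by have [/(_ n)[_ + _] _ _] := pm_graded P; apply. Qed.

Lemma compZ n c p : comp n p -> comp n (ract p c%:A).
Proof. by have [/(_ n)[_ _ +] _ _] := pm_graded P; apply. Qed.

Lemma comp_ract i j p a : comp i p -> gr j a -> comp (i + j)%N (ract p a).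
Proof. by have [_ _] := pm_graded P; apply. Qed.

Lemma compB n p q : comp n p -> comp n q -> comp n (p - q).
Proof.
move=> cp cq; apply: compD => //; rewrite -[q]ract1.
have -> : - ract q 1 = ract q (-1)%:A by rewrite /ract scaleN1r scaleNr.
exact: compZ.
Qed.

(** Directness of the grading for a family starting in degree [k]: it is padded with zeros in the
    degrees below [k]. *)
Lemma comp_sum_eq0 k N (q : nat -> P) :
  (forall i, comp (k + i)%N (q i)) -> \sum_(i < N) q i = 0 ->
  forall i, (i < N)%N -> q i = 0.
Proof.
move=> cq sum0 i ltiN; have [_ [_ uniq_sum] _] := pm_graded P.
pose q' j := if (k <= j)%N then q (j - k)%N else 0.
have q'E j : q' (k + j)%N = q j by rewrite /q' leq_addr addKn.
rewrite -q'E; apply: (uniq_sum (k + N)%N); last by rewrite ltn_add2l.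
  rewrite /q' => j; case: leqP => [lekj|_]; last exact: comp0.
  by rewrite -{1}(subnKC lekj).
rewrite big_split_ord /= big1 ?add0r => [|j _].
  by rewrite -[RHS]sum0; apply: eq_bigr => j _; rewrite q'E.
by rewrite /q' leqNgt ltn_ord.
Qed.

Lemma comp_neq0 n : exists2 q, comp n q & q <> 0.
Proof.
have [e ce eU] := pm_dim1 P n; exists (e ord0) => // e0.
have [c [_ c_uniq]] := eU _ (comp0 n).
(* If the basis vector were 0, every scalar would be a coordinate of 0, against uniqueness. *)
have c0 x : c = [ffun=> x].
  by apply: c_uniq; rewrite big_ord1 e0 ract0l.
have /ffunP/(_ ord0) : [ffun=> 0] = [ffun=> 1] :> {ffun 'I_1 -> F}.
  by rewrite -!c0.
by rewrite !ffunE => /esym/eqP; rewrite oner_eq0.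
Qed.

Lemma comp_line n q p : comp n q -> q <> 0 -> comp n p ->
  exists c : F, p = ract q c%:A.
Proof.
have [e _ eU] := pm_dim1 P n => cq q0 cp.
have [c [+ _]] := eU _ cq; have [c' [+ _]] := eU _ cp.
rewrite !big_ord1 => -> qE; exists ((c ord0)^-1 * c' ord0).
rewrite qE -ractM -scalerAl mul1r scalerA mulrA divff ?mul1r //.
by apply: contra_notN q0 => /eqP c0; rewrite qE c0 scale0r ract0r.
Qed.

(** Writing [p] as [p0] times some [a], the parts of [a] of degree other than [n] contribute
    nothing, by directness of the grading. *)
Lemma comp_generated p0 n p :
  comp 0%N p0 -> (forall q, exists a, q = ract p0 a) -> comp n p ->
  exists2 a, gr n a & p = ract p0 a.
Proof.
move=> c0 gen cp; have [a pE] := gen p; have [f fE] := pi_surj a.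
have [N [b [grb sumb]]] := component_decomposition f.
exists (b n) => //; apply/esym/eqP; rewrite -subr_eq0; apply/eqP.
pose q i := ract p0 (b i) - (if i == n then p else 0).
have -> : ract p0 (b n) - p = q n by rewrite /q eqxx.
(* The range must both exhaust [a] and contain the index [n]. *)
apply: (@comp_sum_eq0 0%N (maxn N n.+1)); last by rewrite leq_maxr.
  move=> i; apply: compB; first by apply: comp_ract.
  by rewrite add0n; case: eqP => [->|_] //; apply: comp0.
rewrite sumrB -ract_sumr -sumb ?leq_maxl // fE -pE -big_mkcond /=.
have ltn : (n < maxn N n.+1)%N by rewrite leq_maxr.
by rewrite (big_pred1 (Ordinal ltn)) ?subrr // => i; rewrite -val_eqE.
Qed.

(** Degree [n + d] is spanned by the images of the generator under words of length [n + d]. The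
    first [n] letters lead to a multiple of [q], so if degree [d] killed [q], all of degree [n + d]
    would vanish. *)
Lemma comp_ract_neq0 n d q : comp n q -> q <> 0 ->
  exists2 a, gr d a & ract q a <> 0.
Proof.
move=> cq q0; apply: contrapT => qA0.
have {}qA0 a : gr d a -> ract q a = 0.
  by move=> ga; apply: contrapT => ?; apply: qA0; exists a.
have [p0 c0 gen] := pm_cyclic P.
have [p cp p_neq0] := comp_neq0 (n + d)%N; apply: p_neq0.
have [a [f homf <-] ->] := comp_generated c0 gen cp.
rewrite pi_sum ract_sumr big_seq big1 // => w /homf; rewrite fdegE => sz_w.
rewrite -[X in word_image X](cat_take_drop n w) word_image_cat scalerAl ractM.
have sz_take : size (take n w) = n by rewrite size_takel // sz_w leq_addr.
have sz_drop : size (drop n w) = d by rewrite size_drop sz_w addKn.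
have cp0 : comp n (ract p0 (f@_w *: word_image (take n w))).
  rewrite -[n in comp n]add0n; apply: comp_ract => //; apply: componentZ.
  by rewrite -{1}sz_take; apply: word_image_component.
have [c cE] := comp_line cq q0 cp0.
rewrite cE ract_scalar qA0 ?ract0l //.
by rewrite -sz_drop; apply: word_image_component.
Qed.

(** Since [f] need not be homogeneous, its parts [b i] are treated one by one: for homogeneous [q],
    the terms of [q f a = 0] lie in distinct degrees, so each [q (b i) a] is 0. *)
Lemma pro_annihilates f : pro gr f -> ann P f.
Proof.
move=> [d _ fd0]; have [g gE] := pi_surj f.
have [N [b [grb sumb]]] := component_decomposition g.
have f_eq0 n q : comp n q -> ract q f = 0.
  move=> cq; rewrite -gE (sumb N) // ract_sumr big1 // => i _.
  apply: contrapT => qb.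
  have [a ga] := comp_ract_neq0 d (comp_ract cq (grb i)) qb.
  apply.
  apply: (@comp_sum_eq0 (n + d)%N N (fun i => ract (ract q (b i)) a)) => //.
    by move=> j; rewrite addnAC; apply: comp_ract => //; apply: comp_ract.
  by rewrite -ract_suml -ract_sumr -sumb // -ractM gE fd0 // ract0r.
move=> p; have [_ [/(_ p)[n [q [cq ->]]] _] _] := pm_graded P.
by rewrite ract_suml big1 // => i _; apply: f_eq0.
Qed.

End PointModule.
End Words.

(** * The action of the free algebra along an infinite word *)

Section Walk.
Variables (F : fieldType) (m : nat) (s : nat -> 'I_m).
Implicit Types (x : 'I_m) (w : seq 'I_m) (p q : {poly F}) (f g : freeAlg F m).

(** Right action of the letter [x], with ['X^n] as the basis vector p_n: the factor ['X] moves to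
    the next position, and only the positions where [s] reads [x] survive. *)
Definition step x p : {poly F} :=
  'X * \poly_(i < size p) (p`_i *+ (s i == x)).

Lemma coef_step x p i :
  (step x p)`_i = if i is j.+1 then p`_j *+ (s j == x) else 0.
Proof.
rewrite coefXM; case: i => //= i; rewrite coef_poly.
by case: ltnP => // /leq_sizeP ->; rewrite ?mul0rn.
Qed.

Lemma step_is_linear x : linear (step x).
Proof.
move=> c p q; apply/polyP => -[|i]; rewrite coefD coefZ !coef_step.
  by rewrite mulr0 addr0.
by rewrite coefD coefZ mulrnDl mulrnAr.
Qed.

HB.instance Definition _ x :=
  GRing.isLinear.Build F {poly F} {poly F} _ (step x) (step_is_linear x).

Definition walk w p : {poly F} := foldl (fun q x => step x q) p w.

Lemma walk_cat u v p : walk (u ++ v) p = walk v (walk u p).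
Proof. exact: foldl_cat. Qed.

Lemma walk_is_linear w : linear (walk w).
Proof.
elim: w => [|x w IHw] c p q //; rewrite /walk /= -!/(walk w _).
by rewrite linearP IHw.
Qed.

HB.instance Definition _ w :=
  GRing.isLinear.Build F {poly F} {poly F} _ (walk w) (walk_is_linear w).

Lemma step_Xn x n : step x 'X^n = 'X^(n.+1) *+ (s n == x).
Proof.
apply/polyP => i; rewrite coef_step coefMn coefXn; case: i => [|i].
  by rewrite mul0rn.
by rewrite coefXn eqSS; case: eqP => [->|_]; rewrite ?mul0rn.
Qed.

Lemma walk_Xn w n :
  walk w 'X^n = 'X^(n + size w) *+ (w == [seq s i | i <- iota n (size w)]).
Proof.
elim: w n => [|x w IHw] n; first by rewrite addn0.
rewrite /walk /= -/(walk w _) step_Xn raddfMn /= IHw addnS -addSn.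
by rewrite -mulrnA mulnb andbC eqseq_cons (eq_sym x).
Qed.

Lemma walkE w p : walk w p = \sum_(i < size p) p`_i *: walk w 'X^i.
Proof.
rewrite -{1}(coefK p) poly_def raddf_sum.
by apply: eq_bigr => i _ /=; rewrite linearZ.
Qed.

(** Here [mmap] only extends [walk] linearly in the word; the result is not multiplicative for the
    product of polynomials. *)
Definition act f p : {poly F} :=
  mmap polyC (fun w : {fmonom 'I_m} => walk w p) f.

Lemma actE f p : act f p = \sum_(w <- msupp f) f@_w *: walk w p.
Proof. by apply: eq_bigr => w _; rewrite mul_polyC. Qed.

Lemma actU c (w : {fmonom 'I_m}) p : act << c *g w >> p = c *: walk w p.
Proof. by rewrite /act mmapU mul_polyC. Qed.

Lemma actDl f g p : act (f + g) p = act f p + act g p.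
Proof. exact: mmapD. Qed.

Lemma actBl f g p : act (f - g) p = act f p - act g p.
Proof. exact: mmapB. Qed.

Lemma act_suml I r (Q : pred I) (f : I -> freeAlg F m) p :
  act (\sum_(i <- r | Q i) f i) p = \sum_(i <- r | Q i) act (f i) p.
Proof. exact: (raddf_sum (mmap polyC (fun w : {fmonom 'I_m} => walk w p))). Qed.

Lemma act_is_linear f : linear (act f).
Proof.
move=> c p q; rewrite !actE scaler_sumr -big_split /=.
by apply: eq_bigr => w _; rewrite linearP scalerDr !scalerA mulrC.
Qed.

HB.instance Definition _ f :=
  GRing.isLinear.Build F {poly F} {poly F} _ (act f) (act_is_linear f).

Lemma actZ c p : act (c *: 1) p = c *: p.
Proof.
have -> : c *: 1 = << c *g @mone {fmonom 'I_m} >> :> freeAlg F m.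
  by apply/malgP => k; rewrite mcoeffZ !mcoeffU mulrnAr mulr1.
by rewrite actU fm1.
Qed.

Lemma actM f g p : act (f * g) p = act g (act f p).
Proof.
rewrite malgME act_suml [act f p]actE raddf_sum /=; apply: eq_bigr => u _.
rewrite act_suml linearZ /= actE scaler_sumr; apply: eq_bigr => v _.
by rewrite actU fmM walk_cat scalerA.
Qed.

Lemma act_Xn_component n d f : free_component d f ->
  exists c, act f 'X^n = c *: 'X^(n + d).
Proof.
move=> homf; exists (\sum_(w <- msupp f)
  f@_w *+ (w == [seq s i | i <- iota n (size w)] :> seq _)).
rewrite actE scaler_suml big_seq [RHS]big_seq; apply: eq_bigr => w /homf.
by rewrite fdegE walk_Xn => <-; rewrite -scalerMnr scalerMnl.
Qed.

(** A word sends [1], which is ['X^0], to a nonzero vector only if it is a prefix of [s], and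
    prefixes of different lengths end at different powers. *)
Lemma coef_act_prefix f n : (act f 1)`_n = f@_(FMonom (mkseq s n)).
Proof.
rewrite actE coef_sum.
have walk1 w : (walk w 1)`_n = (w == mkseq s n)%:R.
  rewrite -[1]/('X^0) walk_Xn add0n coefMn coefXn -/(mkseq s _).
  have [->|/eqP] := eqVneq n (size w); first by rewrite mulr1n.
  by rewrite mul0rn; case: eqVneq => // -> /[!size_mkseq].
rewrite [in RHS](monalgE f) raddf_sum; apply: eq_bigr => w _ /=.
by rewrite coefZ walk1 mcoeffU mulr_natr fmP.
Qed.

End Walk.

(** * The point module of an infinite word *)

Section WalkModule.
Variables (F : fieldType) (m : nat) (A : algType F).
Variable pi : {lrmorphism freeAlg F m -> A}.
Hypothesis pi_surj : forall a, exists f, pi f = a.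
Variable s : nat -> 'I_m.
Hypothesis act_ker : forall f, pi f = 0 -> forall p, act s f p = 0.

Local Notation gr := (quot_component pi).

(** An arbitrary representative through which [A] acts; [act_ker] makes the action independent of
    the choice. *)
Definition lift_pi (a : A) : freeAlg F m := sval (cid (pi_surj a)).

Lemma liftK a : pi (lift_pi a) = a.
Proof. by rewrite /lift_pi; case: cid. Qed.

Lemma act_pi f g p : pi f = pi g -> act s f p = act s g p.
Proof.
move=> fg; apply/eqP; rewrite -subr_eq0 -actBl act_ker // raddfB /= fg.
by rewrite subrr.
Qed.

Lemma act_lift f p : act s (lift_pi (pi f)) p = act s f p.
Proof. by apply: act_pi; rewrite liftK. Qed.

(* The new name hides the F-module structure of {poly F}: scalars are in A^c. *)
Definition walk_module : Type := {poly F}.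

HB.instance Definition _ := GRing.Zmodule.on walk_module.

Definition walk_scale (a : A^c) (p : walk_module) : walk_module :=
  act s (lift_pi a) p.

(** The product is that of [A^c], so [b] acts first, in agreement with [actM]. *)
Fact walk_scaleA a b p :
  walk_scale a (walk_scale b p) = walk_scale (a * b) p.
Proof.
by rewrite /walk_scale -actM; apply: act_pi; rewrite rmorphM /= !liftK.
Qed.

Fact walk_scale1 : left_id 1 walk_scale.
Proof.
move=> p; rewrite -[RHS](scale1r (p : {poly F})) -(actZ s) scale1r.
by apply: act_pi; rewrite liftK rmorph1.
Qed.

Fact walk_scaleDr : right_distributive walk_scale +%R.
Proof. by move=> a p q; apply: raddfD. Qed.

Fact walk_scaleDl p : {morph walk_scale^~ p : a b / a + b}.
Proof.
move=> a b; rewrite /walk_scale -actDl; apply: act_pi.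
by rewrite raddfD /= !liftK.
Qed.

HB.instance Definition _ := GRing.Zmodule_isLmodule.Build A^c walk_module
  walk_scaleA walk_scale1 walk_scaleDr walk_scaleDl.

Lemma ract_pi f (p : walk_module) : ract p (pi f) = act s f p.
Proof. exact: act_lift. Qed.

Lemma ract_walk_scalar (c : F) (p : walk_module) :
  ract p c%:A = c *: (p : {poly F}).
Proof. by rewrite -(rmorph1 pi) -linearZ ract_pi actZ. Qed.

Definition walk_comp (n : nat) : set walk_module :=
  [set p | exists c : F, p = c *: 'X^n :> {poly F}].

Lemma walk_graded : is_graded_module gr walk_comp.
Proof.
split=> [n||i j _ _ [c ->] [f homf <-]].
- split=> [|p q [c ->] [d ->]|c p [d ->]].
  + by exists 0; rewrite scale0r.
  + by exists (c + d); rewrite scalerDl.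
  + by exists (c * d); rewrite ract_walk_scalar scalerA.
- split=> [p|n q cq sum0 i ltin].
    exists (size (p : {poly F})), (fun i => (p : {poly F})`_i *: 'X^i).
    by split=> [i|]; [exists (p : {poly F})`_i | rewrite -[LHS]coefK poly_def].
  (* Directness: the coefficient of ['X^i] isolates the summand [q i]. *)
  have /choice[c cE] := cq.
  have : (\sum_(j < n) (q j : {poly F}))`_i = 0.
    by rewrite (sum0 : \sum_(j < n) (q j : {poly F}) = 0) coef0.
  under eq_bigr do rewrite cE.
  by rewrite -(poly_def n c) coef_poly ltin cE => ->; rewrite scale0r.
- rewrite ract_pi linearZ /=; have [d ->] := act_Xn_component s i homf.
  by exists (c * d); rewrite scalerA.
Qed.

(** The prefix of [s] of length [i] carries [1] to ['X^i]. *)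
Lemma walk_cyclic : cyclic_in_degree0 walk_comp.
Proof.
exists (1 : {poly F}); first by exists 1; rewrite scale1r expr0.
move=> p; exists (pi (\sum_(i < size (p : {poly F}))
  << (p : {poly F})`_i *g FMonom (mkseq s i) >>)).
rewrite ract_pi act_suml -[LHS](coefK (p : {poly F})) poly_def.
apply: eq_bigr => i _; rewrite actU /= -['X^i](_ : walk s (mkseq s i) 1 = _) //.
by rewrite -[1]/('X^0) walk_Xn size_mkseq eqxx.
Qed.

Lemma walk_dim1 n : has_dim (walk_comp n) 1.
Proof.
exists (fun=> 'X^n : {poly F}); first by exists 1; rewrite scale1r.
move=> _ [c ->]; exists [ffun=> c]; split.
  by rewrite big_ord1 ract_walk_scalar ffunE.
move=> d; rewrite big_ord1 ract_walk_scalar.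
move=> /(congr1 (fun p : {poly F} => p`_n)).
rewrite !coefZ coefXn eqxx !mulr1 => cd; apply/ffunP => i.
by rewrite ffunE cd (ord1 i).
Qed.

Definition walk_point_module : point_module gr :=
  PointModule walk_graded walk_cyclic walk_dim1.

Lemma ann_walk_coef_prefix f n :
  ann walk_point_module (pi f) -> f@_(FMonom (mkseq s n)) = 0.
Proof.
move=> /(_ (1 : {poly F})); rewrite ract_pi -coef_act_prefix => ->.
exact: coef0.
Qed.

End WalkModule.

(** The elements acting as 0 form a two-sided ideal, so the generating monomials suffice. One that
    acted nontrivially would be a factor of [s], and the prefix of [s] ending with it would be zero
    in [A]. *)
Lemma act_monomial_ker (F : fieldType) (m : nat) (A : algType F)
    (pi : {lrmorphism freeAlg F m -> A}) (s : nat -> 'I_m) :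
  is_monomial_algebra pi -> (forall n, word_image pi (mkseq s n) <> 0) ->
  forall f, pi f = 0 -> forall p, act s f p = 0.
Proof.
move=> [_ [S kerE]] s_neq0 f f0.
have : gen_ideal [set << w >> | w in S] f by rewrite -kerE.
move/(_ [set g | forall p, act s g p = 0]) => fJ; apply: fJ; split.
  split=> [p|f1 f2 f1K f2K p|r g gK]; first exact: mmap0.
    by rewrite actDl f1K f2K addr0.
  by split=> p; rewrite actM gK // raddf0.
move=> _ [w Sw <-] p; rewrite actU scale1r walkE big1 // => n _.
rewrite walk_Xn; case: eqP => [wE|_]; last by rewrite scaler0.
case: (s_neq0 (n + size w)%N); rewrite /mkseq iotaD map_cat -wE word_image_cat.
have -> : word_image pi w = 0; last by rewrite mulr0.
rewrite /word_image fmK; suff : [set g | pi g = 0] << w >> by [].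
by rewrite kerE => J [_]; apply; exists w.
Qed.

Theorem proposition4p4 (F : fieldType) (m : nat) (A : algType F)
    (pi : {lrmorphism freeAlg F m -> A}) (hA : is_monomial_algebra pi) :
  pro (quot_component pi) = bigcap_ann_point_modules (quot_component pi).
Proof.
have [pi_surj _] := hA.
apply/seteqP; split=> [a pro_a P|a ann_a]; first exact: pro_annihilates.
have [f fE] := pi_surj a.
pose N : set (seq 'I_m) := [set w | word_image pi w <> 0].
have N_prefix u v : N (u ++ v) -> N u.
  by rewrite /N /= word_image_cat; apply: contra_not => ->; rewrite mul0r.
(* A word of [f] that stays nonzero under extensions of every length would be a prefix of some [s]
   with nonzero prefixes, whose module detects its coefficient. *)
have dead w : w \in msupp f ->
    exists d, forall v, size v = d -> word_image pi (w ++ v) = 0.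
  rewrite -mcoeff_neq0 => fw; apply: contrapT => wlive.
  have /(koenig N_prefix)[s [sw sN]] : extendable N w.
    move=> d; apply: contrapT => nov; apply: wlive; exists d => v sv.
    by apply: contrapT => ?; apply: nov; exists v.
  have ker := act_monomial_ker hA sN.
  have := ann_walk_coef_prefix (size w)
    (_ : ann (walk_point_module pi_surj ker) (pi f)).
  by rewrite sw fmK fE => /(_ (ann_a _))/eqP; rewrite (negPf fw).
have /choice[d dP] : forall w : {fmonom 'I_m}, exists d, w \in msupp f ->
    forall v, size v = d -> word_image pi (w ++ v) = 0.
  move=> w; have [/dead[d dP]|_] := boolP (w \in msupp f); first by exists d.
  by exists 0%N.
(* One degree serves all the words of [f]; the successor makes it positive. *)
exists (\max_(w <- msupp f) d w).+1 => // _ [g homg <-].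
rewrite -fE !pi_sum mulr_suml big_seq big1 // => w wf.
rewrite mulr_sumr big_seq big1 // => v /homg; rewrite fdegE => sz_v.
have led : (d w <= size v)%N.
  by rewrite sz_v leqW // (@leq_bigmax_seq _ _ _ d).
rewrite -scalerAl -scalerAr -word_image_cat.
rewrite -[X in word_image pi (_ ++ X)](cat_take_drop (d w) v) catA.
rewrite word_image_cat dP ?mul0r ?scaler0 //.
by rewrite size_takel.
Qed.
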